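(* Let $\mathcal{G}$ be a nonbipartite $\mathcal{F}_{g,l}$-graph of order $n\geq g+1$ with $g\geq 5$ and $\gamma(\mathcal{G})=\frac{n-1}{2}$, and suppose exactly $f$ vertices of the cycle $\mathbb{C}=v_1\cdots v_gv_1$ are not $p$-dominators. Then: (i) if $f=g$, then $g=5$; (ii) if $f\neq g$, then $f\leq 3$ and $f\neq 2$; (iii) if $f=3$, then these three vertices are consecutive on $\mathbb{C}$, i.e., they are $v_{i-1},v_i,v_{i+1}$ for some $1\leq i<g$ (with $v_0=v_g$), and every vertex of $V(\mathbb{C})\setminus\{v_{i-1},v_i,v_{i+1}\}$ and every vertex of $\{v_{g+1},\ldots,v_{g+l-1}\}$ is a $p$-dominator.
   Context: All graphs are simple and connected. $\gamma$ is the domination number. A pendant vertex has degree 1; a $p$-dominator is a vertex adjacent to a pendant vertex. The lollipop graph $L_{g,l}$ ($l\geq 1$) consists of a cycle $\mathbb{C}=v_1v_2\cdots v_gv_1$ and a path $\mathbb{P}=v_gv_{g+1}\cdots v_{g+l}$. An $F_{g,l}$-graph of order $n$ is obtained from $L_{g,l}$ by attaching $n-g-l$ pendant vertices to some nonpendant vertices of $L_{g,l}$. An $\mathcal{F}_{g,l}$-graph is an $F_{g,l}$-graph in which every $p$-dominator other than $v_{g+l-1}$ is adjacent to exactly one pendant vertex. *)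

(* Defs.v *)
From mathcomp Require Import all_boot.

Set Implicit Arguments.
Unset Strict Implicit.
Unset Printing Implicit Defensive.

(* A simple graph is a symmetric irreflexive relation [e] on a finType [T]. *)
Section SimpleGraphs.
Variables (T : finType) (e : rel T).

Definition simple_graph : Prop := symmetric e /\ irreflexive e.

Definition connected_graph : Prop := forall x y : T, connect e x y.

Definition bipartite : Prop :=
  exists A : {set T}, forall x y, e x y -> (x \in A) != (y \in A).

Definition nbrs (x : T) : {set T} := [set y | e x y].

Definition pendant (x : T) : bool := #|nbrs x| == 1.

Definition pendant_nbrs (x : T) : {set T} := [set y in nbrs x | pendant y].

Definition p_dominator (x : T) : bool := [exists y, e x y && pendant y].

Definition dominating (D : {set T}) : bool :=
  [forall x, (x \in D) || [exists y in D, e x y]].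

Definition domination_number : nat :=
  #|[arg min_(D < [set: T] | dominating D) #|D| ]|.

End SimpleGraphs.

(* The vertices of the lollipop graph L_{g,l} are the indices 1, ..., g + l,
   index i standing for v_i; this is its adjacency on those indices. *)
Definition lollipop_adj (g i j : nat) : bool :=
  [|| j == i.+1, i == j.+1, (i == 1) && (j == g) | (i == g) && (j == 1)].

Section LollipopGraphs.
Variables (g l : nat) (T : finType) (e : rel T).
(* [v i] is the vertex v_i; only the values at 1 <= i <= g + l matter. *)
Variable v : nat -> T.

(* The vertices v_1, ..., v_{g+l} induce L_{g,l}, and every other vertex is
   adjacent to a single vertex v_i, nonpendant in L_{g,l}, i.e. i != g + l. *)
Definition F_graph : Prop :=
  [/\ 3 <= g, 1 <= l,
      {in [pred i | 1 <= i <= g + l] &, injective v},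
      {in [pred i | 1 <= i <= g + l] &,
        forall i j, e (v i) (v j) = lollipop_adj g i j}
    & forall x : T, (forall i, 1 <= i <= g + l -> x <> v i) ->
        exists2 i, 1 <= i < g + l & nbrs e x = [set v i]].

Definition calF_graph : Prop :=
  F_graph /\
  forall x : T, p_dominator e x -> x <> v (g + l - 1) ->
    #|pendant_nbrs e x| = 1.

Definition cycle_vertices : {set T} := [set v (k : 'I_g).+1 | k : 'I_g].

Definition cycle_non_p_dominators : {set T} :=
  [set x in cycle_vertices | ~~ p_dominator e x].

(* v_j with the convention v_0 = v_g *)
Definition cycle_vertex (j : nat) : T := if j == 0 then v g else v j.

End LollipopGraphs.

(* Main.v *)
Require Import Defs.
From mathcomp Require Import all_boot zify.

(* Let S be the set of p-dominators and U the set of the vertices v_i, i < g + l,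
   outside S.  Each p-dominator has its own pendant vertex, so n >= 2|S| + |U|;
   if S together with X is dominating, then (n - 1)/2 = gamma <= |S| + |X|, hence
   |U| <= 2|X| + 1.  A greedy left-to-right choice of X on v_1, ..., v_{g+l-1}
   has |U| - 2|X| equal to a sum over the maximal runs of U, a run of length a
   contributing a - 2 floor(a/3), which is 1 only for a = 1, 3 and is at least 2
   for every other positive a.
   If v_g is in S this leaves at most one run, of length 1 or 3.  If v_g is in U,
   taking v_g in X bounds the contributions of the runs of U minus v_g by 2, and
   whenever a neighbour of v_g lies in S a choice of X avoiding v_g eliminates
   everything except U = {v_g} and U = {v_g} plus two vertices following v_g
   along one of the three branches.  A cycle contained in U gives g in {5, 7},
   and X = {v_2, v_5} excludes g = 7. *)

Set Implicit Arguments.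
Unset Strict Implicit.
Unset Printing Implicit Defensive.

(** * Greedy domination of a path *)

(* [u i] says that v_i is not a p-dominator, [N] is g + l - 1. *)
Definition tight (g N : nat) (u : pred nat) : Prop :=
  forall X : seq nat,
    (forall i, 1 <= i <= N -> u i ->
       exists2 j, 1 <= j <= N &
         ((j == i) || lollipop_adj g i j) && (~~ u j || (j \in X))) ->
    count u (iota 1 N) <= (size X).*2.+1.

(* What is known when a scan reaches index k: v_k is dominated from the left
   ([Covered]), nothing is known about v_k ([Free]), or v_{k-1} must be dominated
   by v_k ([Pending]). *)
Variant scan_state := Covered | Free | Pending.

(* |U| - 2|X| for the greedy X on the indices k, ..., k + m - 1, index k + m being
   outside U; a vertex is put in X exactly when it is in U and reached in state
   [Pending], and the pending v_{k-1} is counted with the block. *)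
Fixpoint defect (s : scan_state) (u : pred nat) (k m : nat) : nat :=
  if m is m'.+1 then
    if u k then
      match s with
      | Covered => (defect Free u k.+1 m').+1
      | Free => defect Pending u k.+1 m'
      | Pending => defect Covered u k.+1 m'
      end
    else (if s is Pending then 1 else 0) + defect Covered u k.+1 m'
  else if s is Pending then 1 else 0.

Lemma near_widen (a b c : bool) k i :
  [|| a, b | (k.+1 < i) && c] -> [|| a, b | (k < i) && c].
Proof. by case/or3P => [->|->|/andP[/ltnW-> ->]]; rewrite ?orbT. Qed.

(** Each index of [u] counts 1, and a chosen index pays 2, for itself and for the pending index
    before it; what stays unpaid is the defect. The entry index in state [Covered] is exempt, being
    dominated from outside the block; the guard [k < i] keeps all other left neighbours inside
    it. *)
Lemma greedy_scan (u : pred nat) m k (s : scan_state) : u (k + m) = false ->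
  exists X : seq nat,
    let c j := ~~ u j || (j \in X) in
    [/\ (size X).*2 + defect s u k m
          = count u (iota k m) + (if s is Pending then 1 else 0),
        s = Pending -> c k
      & forall i, k <= i < k + m -> s = Covered /\ i = k
          \/ [|| c i, c i.+1 | (k < i) && c i.-1]].
Proof.
elim: m k s => [|m IHm] k s /=; rewrite ?addn0 ?addnS -?addSn => uend.
  by exists [::]; split=> [||i]; [|rewrite uend|lia].
case uk: (u k).
- case: s.
  + have [X [sizeX _ domX]] := IHm k.+1 Free uend.
    exists X; split=> // [|i iP]; first by lia.
    have [->|ik] := eqVneq i k; first by left.
    by right; case: (domX i) => [|[]//|/near_widen//]; lia.
  + have [X [sizeX domk domX]] := IHm k.+1 Pending uend.
    exists X; split=> // [|i iP]; first by lia.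
    have [->|ik] := eqVneq i k; first by right; rewrite domk ?orbT.
    by right; case: (domX i) => [|[]//|/near_widen//]; lia.
  + have [X [sizeX _ domX]] := IHm k.+1 Covered uend.
    (* The chosen v_k dominates the pending v_{k-1}, itself and v_{k+1}, so the scan resumes in
       state [Covered]. *)
    exists (k :: X); split=> /= [|_|i iP]; first by lia.
      by rewrite inE eqxx.
    rewrite !inE; right.
    have [->|ik] := eqVneq i k; first by rewrite ?eqxx orbT.
    case: (domX i) => [|[_ ->]|]; first by lia.
      by rewrite ltnSn eqxx !orbT.
    case/near_widen/or3P => [/orP[]->|/orP[]->|/andP[-> /orP[]->]];
      by rewrite ?orbT.
- have [X [sizeX _ domX]] := IHm k.+1 Covered uend.
  exists X; split=> /= [|_|i iP]; rewrite ?uk //; first by lia.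
  have [->|ik] := eqVneq i k; first by rewrite uk; right.
  right; case: (domX i) => [|[_ ->]|/near_widen//]; first by lia.
  by rewrite /= ltnSn uk !orbT.
Qed.

Lemma eq_defect s (u w : pred nat) k m :
  (forall i, k <= i < k + m -> u i = w i) -> defect s u k m = defect s w k m.
Proof.
elim: m k s => [|m IHm] k s //= uw; rewrite uw; last by lia.
have IH s' : defect s' u k.+1 m = defect s' w k.+1 m.
  by apply: IHm => i iP; apply: uw; lia.
by rewrite !IH.
Qed.

(** A vertex outside U resolves a pending predecessor and dominates its successor, so the scan
    restarts there and the two sides do not interact. *)
Lemma defect_split s (u : pred nat) k m1 m2 : u (k + m1) = false ->
  defect s u k (m1 + m2.+1) = defect s u k m1 + defect Covered u (k + m1).+1 m2.
Proof.
elim: m1 k s => [|m1 IHm] k s /=.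
  by rewrite addn0 => ->; case: s.
rewrite addnS -addSn => um; case: (u k); case: s => /=; rewrite IHm //; lia.
Qed.

Lemma defect_Covered_eq0 (u : pred nat) k m : defect Covered u k m = 0 ->
  forall i, k <= i < k + m -> u i = false.
Proof.
elim: m k => [|m IHm] k /=; first by lia.
case uk: (u k) => // /IHm none i iP.
by have [->//|ik] := eqVneq i k; apply: none; lia.
Qed.

(** From state [Free] only an initial run of exactly two is free of charge: its second vertex is
    chosen, and any later vertex of U would be met in state [Covered], at cost 1. *)
Lemma defect_Free_eq0 (u : pred nat) k m : defect Free u k m = 0 ->
  (forall i, k <= i < k + m -> u i = false) \/
  [/\ 1 < m, u k, u k.+1 & forall i, k.+2 <= i < k + m -> u i = false].
Proof.
case: m => [|m] /=; first by left; lia.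
case uk: (u k); last first.
  move=> /defect_Covered_eq0 none.
  by left=> i iP; have [->//|ik] := eqVneq i k; apply: none; lia.
case: m => [//|m] /=; case uk1: (u k.+1) => // /defect_Covered_eq0 none.
by right; split=> // i iP; apply: none; lia.
Qed.

(** The first vertex [p] of U is met in state [Covered] and uses up the unit allowed. With
    [defect_Free_eq0] this leaves a single run, of length 1 or 3. *)
Lemma defect_Covered_le1 (u : pred nat) k m : defect Covered u k m <= 1 ->
  (forall i, k <= i < k + m -> u i = false) \/
  exists2 p, k <= p < k + m &
    [/\ u p, forall i, k <= i < p -> u i = false
      & defect Free u p.+1 (k + m - p.+1) = 0].
Proof.
elim: m k => [|m IHm] k /=; first by left; lia.
case uk: (u k); last first.
  case/IHm=> [none|[p pP [up none d0]]].
    by left=> i iP; have [->//|ik] := eqVneq i k; apply: none; lia.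
  right; exists p; first by lia.
  split=> // [i iP|]; last by rewrite addnS -addSn.
  by have [->//|ik] := eqVneq i k; apply: none; lia.
move=> d0; right; exists k; first by lia.
split=> //; first by lia.
by rewrite addnS subSS addKn; lia.
Qed.

Lemma defect_Covered_gt0 (u : pred nat) k m i : k <= i < k + m -> u i ->
  0 < defect Covered u k m.
Proof.
move=> iP ui; rewrite lt0n; apply/eqP => /defect_Covered_eq0 none.
by rewrite none in ui.
Qed.

Lemma defect_Covered_all3 (u : pred nat) k m :
  (forall i, k <= i < k + m.+3 -> u i) ->
  defect Covered u k m.+3 = (defect Covered u k.+3 m).+1.
Proof. by move=> all_u /=; rewrite !all_u //; lia. Qed.

(** * Lollipop indices *)

Lemma count_le_size (u : pred nat) k m (L : seq nat) :
  (forall i, k <= i < k + m -> u i -> i \in L) -> count u (iota k m) <= size L.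
Proof.
move=> sub; rewrite -size_filter; apply: uniq_leq_size.
  by rewrite filter_uniq ?iota_uniq.
by move=> i; rewrite mem_filter mem_iota => /andP[ui iP]; apply: sub.
Qed.

Lemma count_ge_size (u : pred nat) k m (L : seq nat) : uniq L ->
  (forall i, i \in L -> (k <= i < k + m) && u i) -> size L <= count u (iota k m).
Proof.
move=> uniqL sub; rewrite -size_filter; apply: uniq_leq_size => // i /sub.
by rewrite mem_filter mem_iota andbC.
Qed.

Lemma lollipop_adjS g i : lollipop_adj g i i.+1.
Proof. by rewrite /lollipop_adj eqxx. Qed.

Lemma lollipop_adjC g i j : lollipop_adj g i j = lollipop_adj g j i.
Proof.
rewrite /lollipop_adj orbCA; do 2 congr (_ || _).
by rewrite orbC ![(_ == 1) && _]andbC.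
Qed.

Lemma lollipop_adj1g g : lollipop_adj g 1 g.
Proof. by rewrite /lollipop_adj !eqxx !orbT. Qed.

Lemma defect_Covered_pair (u : pred nat) k m : 1 < m -> u k -> u k.+1 ->
  (2 < m -> u k.+2 = false) -> 2 <= defect Covered u k m.
Proof.
by case: m => [|[|[|m]]] //= _ -> -> // ->.
Qed.

(** * Consequences of tightness for the position of U on the lollipop *)

Section Tight.

Variables (g N : nat).
Hypotheses (g_ge5 : 5 <= g) (leqgN : g <= N).

Lemma count_last (u : pred nat) : u N = false ->
  count u (iota 1 N.-1) = count u (iota 1 N).
Proof.
move=> uN; have -> : iota 1 N = iota 1 (N.-1 + 1) by congr iota; lia.
by rewrite iotaD count_cat /= add1n prednK ?uN; lia.
Qed.

Lemma lt_last (u : pred nat) i : u N = false -> 1 <= i <= N -> u i -> i < N.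
Proof.
move=> uN iP ui; rewrite ltn_neqAle; case: eqP ui => [->|_ _]; first by rewrite uN.
by lia.
Qed.

Lemma near_dominated (c : pred nat) i : 1 <= i < N ->
  [|| c i, c i.+1 | (1 < i) && c i.-1] ->
  exists2 j, 1 <= j <= N & ((j == i) || lollipop_adj g i j) && c j.
Proof.
move=> iP /or3P[ci|ci|/andP[i1 ci]].
- by exists i; rewrite ?eqxx //; lia.
- by exists i.+1; rewrite ?lollipop_adjS ?orbT //; lia.
exists i.-1; first by lia.
by rewrite ci lollipop_adjC -[X in lollipop_adj _ _ X](@prednK i)
           ?lollipop_adjS ?orbT //; lia.
Qed.

(** As v_g is in S, it dominates v_1, so the scan may start in state [Covered]. *)
Lemma tight_Covered (u : pred nat) : tight g N u -> u N = false ->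
  u g = false -> defect Covered u 1 N.-1 <= 1.
Proof.
move=> tu uN ug.
have [|X [sizeX _ domX]] := @greedy_scan u N.-1 1 Covered.
  by rewrite add1n prednK //; lia.
suff /tu: forall i, 1 <= i <= N -> u i ->
       exists2 j, 1 <= j <= N &
         ((j == i) || lollipop_adj g i j) && (~~ u j || (j \in X)).
  by rewrite -count_last //; lia.
move=> i iP ui; have iN := lt_last uN iP ui.
case: (domX i) => [|[_ ->]|]; first by lia.
  by exists g; rewrite ?ug ?lollipop_adj1g ?orbT //; lia.
by apply: (near_dominated (c := fun j => ~~ u j || (j \in X))); lia.
Qed.

(** With v_g in X, both v_1 and v_{g+1} are dominated, so each side is scanned from [Covered].
    Choosing v_g raises the bound on |U| by 2 while v_g counts once in U, which turns 1 into 2. *)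
Lemma tight_center (u : pred nat) : tight g N u -> u N = false ->
  u g -> defect Covered u 1 g.-1 + defect Covered u g.+1 (N - g.+1) <= 2.
Proof.
move=> tu uN ug; have ltgN: g < N by apply: lt_last ug => //; lia.
pose w i := u i && (i != g).
have wu i : i != g -> w i = u i by rewrite /w => ->; rewrite andbT.
have wg : w g = false by rewrite /w eqxx andbF.
have -> : defect Covered u 1 g.-1 + defect Covered u g.+1 (N - g.+1) =
          defect Covered w 1 N.-1.
  have -> : N.-1 = g.-1 + (N - g.+1).+1 by lia.
  rewrite defect_split ?add1n ?prednK //; try lia.
  by congr (_ + _); apply: eq_defect => i iP; rewrite wu //; lia.
have [|X [sizeX _ domX]] := @greedy_scan w N.-1 1 Covered.
  by rewrite add1n prednK /w ?uN //; lia.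
suff /tu: forall i, 1 <= i <= N -> u i ->
       exists2 j, 1 <= j <= N &
         ((j == i) || lollipop_adj g i j) && (~~ u j || (j \in g :: X)).
  have -> : count u (iota 1 N) = (count w (iota 1 N.-1)).+1.
    rewrite -count_last // (eq_count (a2 := predU w (pred1 g))); last first.
      by move=> i /=; rewrite /w; case: eqVneq => [->|]; rewrite ?ug ?andbT ?orbF.
    have := count_predUI w (pred1 g) (iota 1 N.-1).
    rewrite (@eq_count _ (predI _ _) pred0) ?count_pred0; last first.
      by move=> i /=; rewrite /w; case: eqP; rewrite ?andbF.
    by rewrite (count_uniq_mem _ (iota_uniq _ _)) mem_iota; lia.
  by rewrite /=; lia.
move=> i iP ui; have iN := lt_last uN iP ui.
have [->|ig] := eqVneq i g; first by exists g; rewrite ?inE ?eqxx ?orbT; lia.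
have cw j : ~~ w j || (j \in X) -> ~~ u j || (j \in g :: X).
  by rewrite /w inE; case: eqP; case: (u j); rewrite ?orbT.
case: (domX i) => [|[_ ->]|near]; first by lia.
  by exists g; rewrite ?inE ?eqxx ?lollipop_adj1g ?orbT //; lia.
have [|j jP /andP[adj_ij /cw cj]] :=
  near_dominated (c := fun j => ~~ w j || (j \in X)) _ near; first by lia.
by exists j; rewrite ?adj_ij.
Qed.

Lemma tight_Free (u : pred nat) : tight g N u -> u N = false ->
  defect Free u 1 N.-1 <= 1.
Proof.
move=> tu uN.
have [|X [sizeX _ domX]] := @greedy_scan u N.-1 1 Free.
  by rewrite add1n prednK //; lia.
suff /tu: forall i, 1 <= i <= N -> u i ->
       exists2 j, 1 <= j <= N &
         ((j == i) || lollipop_adj g i j) && (~~ u j || (j \in X)).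
  by rewrite -count_last //; lia.
move=> i iP ui; have iN := lt_last uN iP ui.
case: (domX i) => [|[]//|]; first by lia.
by apply: (near_dominated (c := fun j => ~~ u j || (j \in X))); lia.
Qed.

(** As v_{g-1} is in S, v_g is met in state [Covered] and stays out of X. It uses the whole unit
    allowed by [tight_Free], so the blocks on either side, scanned from [Free], each contain no
    vertex of U or just an initial pair. *)
Lemma tight_end_covered (u : pred nat) : tight g N u -> u N = false ->
  u g -> u g.-1 = false ->
  exists2 L : seq nat, L \in [:: [:: g]; [:: g; 1; 2]; [:: g; g.+1; g.+2]] &
    forall i, 1 <= i <= N -> u i = (i \in L).
Proof.
move=> tu uN ug ug1; have ltgN: g < N by apply: lt_last ug => //; lia.
have := tight_Free tu uN; have := tight_center tu uN ug.
have -> : N.-1 = g.-2 + (N - g).+1 by lia.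
rewrite [in X in _ -> X]defect_split; last by rewrite -ug1; congr u; lia.
have -> : N - g = (N - g.+1).+1 by lia.
have -> : (1 + g.-2).+1 = g by lia.
rewrite [X in _ -> _ + X <= _ -> _]/= ug => d2 d1.
have [d0 d0'] : defect Free u 1 g.-2 = 0 /\ defect Free u g.+1 (N - g.+1) = 0 by lia.
have split_i i : 1 <= i <= N -> [\/ 1 <= i < 1 + g.-2, i = g.-1,
    g.+1 <= i < g.+1 + (N - g.+1) \/ i = g | i = N].
  move=> iP; have [lt_ig1|gt_ig1|->] := ltngtP i g.-1; last by apply: Or42.
    by apply: Or41; lia.
  have [->|gi] := eqVneq i g; first by apply: Or43; right.
  have [->|iN] := eqVneq i N; first by apply: Or44.
  by apply: Or43; left; lia.
have [none|[_ u1 u2 none]] := defect_Free_eq0 d0;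
have [none'|[gN ug1' ug2 none']] := defect_Free_eq0 d0'.
- exists [:: g]; first by rewrite inE eqxx.
  move=> i /split_i[iP|->|[iP|->]|->].
  + by rewrite none // inE; lia.
  + by rewrite ug1 inE; lia.
  + by rewrite none' // inE; lia.
  + by rewrite ug inE eqxx.
  + by rewrite uN inE; lia.
- exists [:: g; g.+1; g.+2]; first by rewrite !inE eqxx !orbT.
  move=> i /split_i[iP|->|[iP|->]|->].
  + by rewrite none // !inE; lia.
  + by rewrite ug1 !inE; lia.
  + have [->|] := eqVneq i g.+1; first by rewrite ug1' !inE eqxx orbT.
    have [->|i1 i2] := eqVneq i g.+2; first by rewrite ug2 !inE eqxx !orbT.
    by rewrite none' ?inE; lia.
  + by rewrite ug inE eqxx.
  + by rewrite uN !inE; lia.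
- exists [:: g; 1; 2]; first by rewrite !inE eqxx !orbT.
  move=> i /split_i[iP|->|[iP|->]|->].
  + have [->|] := eqVneq i 1; first by rewrite u1 !inE orbT.
    have [->|i1 i2] := eqVneq i 2; first by rewrite u2 !inE !orbT.
    by rewrite none ?inE; lia.
  + by rewrite ug1 !inE; lia.
  + by rewrite none' // !inE; lia.
  + by rewrite ug inE eqxx.
  + by rewrite uN !inE; lia.
(* Pairs on both sides would contribute 2 + 2, against the bound 2 of [tight_center]. *)
have: 2 <= defect Covered u 1 g.-1.
  by apply: defect_Covered_pair => //; [lia|move=> _; apply: none; lia].
have: 2 <= defect Covered u g.+1 (N - g.+1).
  by apply: defect_Covered_pair => // gN'; apply: none'; lia.
by lia.
Qed.

(** By [tight_center] a run of g - 1 vertices may contribute at most 2. It contributes 3 for g = 6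
    and at least 3 for g >= 8; besides g = 5, only g = 7 stays at 2. *)
Lemma tight_full_cycle (u : pred nat) : tight g N u -> u N = false ->
  (forall i, 1 <= i <= g -> u i) -> g = 5.
Proof.
move=> tu uN all_u; have ug : u g by apply: all_u; lia.
have ltgN: g < N by apply: lt_last ug => //; lia.
have := tight_center tu uN ug.
have [//|g5] := eqVneq g 5.
have [g6|g6] := eqVneq g 6.
  by rewrite g6 defect_Covered_all3 /= ?all_u ?g6 // => *; apply: all_u; lia.
have [g7|g7] := eqVneq g 7; last first.
  have -> : g.-1 = (g - 7).+3.+3 by lia.
  rewrite !defect_Covered_all3; try by move=> *; apply: all_u; lia.
  have : 0 < defect Covered u 7 (g - 7).
    by apply: (@defect_Covered_gt0 _ _ _ 7); [lia|apply: all_u; lia].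
  by lia.
(* For g = 7 the cycle exhausts the bound, so the tail lies in S and v_8 dominates v_7. *)
rewrite g7 !defect_Covered_all3 /=; try by move=> *; apply: all_u; lia.
rewrite addSn => d0.
have none : forall i, 8 <= i < 8 + (N - 8) -> u i = false.
  by apply: defect_Covered_eq0; lia.
have u8 : u 8 = false.
  have [<-|N8] := eqVneq N 8; first by rewrite uN.
  by apply: none; lia.
have : 7 <= count u (iota 1 N).
  apply: (@count_ge_size u 1 N (iota 1 7)) => // i; rewrite mem_iota => iP.
  by rewrite all_u; lia.
(* The choice {v_2, v_5} dominates v_1, ..., v_6 and gives |U| <= 5, against |U| >= 7. *)
suff /tu /= : forall i, 1 <= i <= N -> u i -> exists2 j, 1 <= j <= N &
    ((j == i) || lollipop_adj g i j) && (~~ u j || (j \in [:: 2; 5])).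
  by rewrite /=; lia.
move=> i iP ui; have iN := lt_last uN iP ui.
have [i8|i7] := leqP 8 i; first by rewrite none in ui => //; lia.
have [->|i7'] := eqVneq i 7; first by exists 8; rewrite ?u8 ?lollipop_adjS ?orbT //; lia.
exists (if i <= 3 then 2 else 5); first by case: ifP; lia.
by rewrite g7 /lollipop_adj;
  case: i iP i7 i7' {ui iN} => [|[|[|[|[|[|[|[|i]]]]]]]] //=; rewrite ?orbT.
Qed.

(** Both arcs between v_g and v_p meet U, so each contributes exactly 1 and the tail nothing. Hence
    v_{g+1} is in S and dominates v_g, which can be left out of X; this saving contradicts
    tightness. *)
Lemma tight_ends_covered (u : pred nat) p : tight g N u -> u N = false ->
  u g -> 1 <= p <= g -> u p = false -> u 1 -> u g.-1 -> False.
Proof.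
move=> tu uN ug pP up u1 ug1.
have ltgN: g < N by apply: lt_last ug => //; lia.
have p1 : 1 < p by case: p pP up => [|[|p]] //; rewrite u1.
have pg : p < g.-1.
  have : p != g by apply/eqP => pg; rewrite pg ug in up.
  have : p != g.-1 by apply/eqP => pg; rewrite pg ug1 in up.
  by lia.
have := tight_center tu uN ug.
have -> : g.-1 = p.-1 + (g - p.+1).+1 by lia.
rewrite defect_split add1n prednK //; try lia.
have dl : 0 < defect Covered u 1 p.-1.
  by apply: (@defect_Covered_gt0 _ _ _ 1) => //; lia.
have dr : 0 < defect Covered u p.+1 (g - p.+1).
  by apply: (@defect_Covered_gt0 _ _ _ g.-1) => //; lia.
move=> d2.
have none : forall i, g.+1 <= i < g.+1 + (N - g.+1) -> u i = false.
  by apply: defect_Covered_eq0; lia.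
have ugS : u g.+1 = false.
  have [<-|N8] := eqVneq N g.+1; first by rewrite uN.
  by apply: none; lia.
(* The run of U at v_1 is v_1 alone, dominated by v_2 in S, or v_1, v_2, v_3, dominated by choosing
   v_2. *)
have [X1 [L1 [sizeL1 uniqL1 L1u domX1]]] : exists X1 L1 : seq nat,
    [/\ size L1 = (size X1).*2.+1, uniq L1,
        forall i, i \in L1 -> (1 <= i < p) && u i
      & forall i, 1 <= i < p -> u i -> exists2 j, 1 <= j <= p &
          ((j == i) || lollipop_adj g i j) && (~~ u j || (j \in X1))].
  have [|none1|[q qP [uq none1 /defect_Free_eq0 d0]]] :=
    @defect_Covered_le1 u 1 p.-1; first by lia.
    by move: u1; rewrite none1; lia.
  have {none1} q1 : q = 1.
    by case: (ltngtP q 1) => //; [lia|move=> q1; move: u1; rewrite none1; lia].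
  rewrite {}q1 add1n prednK in qP uq d0; last by lia.
  case: d0 => [none1|[p3 u2 u3 none1]].
    exists [::], [:: 1]; split=> // [i|i iP ui].
      by rewrite inE => /eqP->; rewrite u1; lia.
    have [i1|i1] := eqVneq i 1; last by move: ui; rewrite none1; lia.
    rewrite i1; exists 2; rewrite ?lollipop_adjS ?orbT //=.
    have [<-|p2] := eqVneq p 2; first by rewrite up.
    by rewrite none1 //; lia.
  exists [:: 2], [:: 1; 2; 3]; split=> // [i|i iP ui].
    by rewrite !inE => /or3P[] /eqP->; rewrite ?u1 ?u2 ?u3; lia.
  have i3 : i < 4 by rewrite ltnNge; apply/negP => i4; move: ui; rewrite none1; lia.
  exists 2; first by lia.
  by case: i i3 iP {ui} => [|[|[|[|i]]]] //= _ _; rewrite /lollipop_adj !orbT.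
(* The only run in this arc must end at v_{g-1}: it is v_{g-1} alone, or the three vertices centred
   at v_{g-2}, which is then chosen. *)
have [X2 [L2 [sizeL2 uniqL2 L2u domX2]]] : exists X2 L2 : seq nat,
    [/\ size L2 = (size X2).*2.+1, uniq L2,
        forall i, i \in L2 -> (p < i < g) && u i
      & forall i, p < i < g -> u i -> exists2 j, p <= j < g &
          ((j == i) || lollipop_adj g i j) && (~~ u j || (j \in X2))].
  have [|none2|[q qP [uq none2 /defect_Free_eq0 d0]]] :=
    @defect_Covered_le1 u p.+1 (g - p.+1).
  - by lia.
  - by move: ug1; rewrite none2; lia.
  rewrite (_ : p.+1 + (g - p.+1) = g) in qP d0; last by lia.
  case: d0 => [none3|[gq uq1 uq2 none3]].
    have q1 : q = g.-1.
      by apply/eqP/contraT => qg; move: ug1; rewrite none3; lia.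
    exists [::], [:: q]; split=> // [i|i iP ui].
      by rewrite inE => /eqP->; rewrite uq; lia.
    have [i1|i1] := ltnP i q; first by move: ui; rewrite none2; lia.
    exists i.-1; first by lia.
    rewrite lollipop_adjC -[X in lollipop_adj _ _ X](@prednK i); last by lia.
    rewrite lollipop_adjS orbT /= orbF.
    have [->|p2] := eqVneq i.-1 p; first by rewrite up.
    by rewrite none2 //; lia.
  have q3 : q.+3 = g.
    by apply/eqP/contraT => qg; move: ug1; rewrite none3; lia.
  exists [:: q.+1], [:: q; q.+1; q.+2]; split=> // [|i|i iP ui].
  - by rewrite /= !inE; lia.
  - by rewrite !inE => /or3P[] /eqP->; rewrite ?uq ?uq1 ?uq2; lia.
  have i3 : q <= i by rewrite leqNgt; apply/negP => i4; move: ui; rewrite none2; lia.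
  exists q.+1; first by lia.
  by rewrite inE eqxx !orbT andbT /lollipop_adj; lia.
(* |U| is at least 1 + (2|X1| + 1) + (2|X2| + 1), two more than tightness allows for [X1 ++ X2]. *)
have : size (g :: L1 ++ L2) <= count u (iota 1 N).
  apply: count_ge_size.
    rewrite /= cat_uniq uniqL1 uniqL2 mem_cat negb_or /= andbT.
    rewrite -?andbA; apply/and3P; split.
    - by apply/negP => /L1u; lia.
    - by apply/negP => /L2u; lia.
    by apply/hasPn => i /L2u iP; apply/negP => /L1u; lia.
  move=> i; rewrite inE mem_cat => /or3P[/eqP->|/L1u/andP[iP ->]|/L2u/andP[iP ->]].
  - by rewrite ug; lia.
  - by lia.
  by lia.
suff /tu : forall i, 1 <= i <= N -> u i -> exists2 j, 1 <= j <= N &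
    ((j == i) || lollipop_adj g i j) && (~~ u j || (j \in X1 ++ X2)).
  by rewrite size_cat /= size_cat; lia.
move=> i iP ui; have iN := lt_last uN iP ui.
have [ltip|gtip|eqip] := ltngtP i p; last by rewrite eqip up in ui.
  have [|j jP /andP[adj_ij /orP[]cj]] := domX1 i _ ui; first by lia.
    by exists j; rewrite ?adj_ij ?cj //; lia.
  by exists j; rewrite ?adj_ij ?mem_cat ?cj ?orbT //; lia.
have [ltig|gtig|->] := ltngtP i g.
- have [|j jP /andP[adj_ij /orP[]cj]] := domX2 i _ ui; first by lia.
    by exists j; rewrite ?adj_ij ?cj //; lia.
  by exists j; rewrite ?adj_ij ?mem_cat ?cj ?orbT //; lia.
- by move: ui; rewrite none; lia.
by exists g.+1; rewrite ?ugS ?lollipop_adjS ?orbT.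
Qed.

(** The lollipop automorphism fixing v_g and the tail; it exchanges the two cycle neighbours of v_g,
    so only one of them needs treatment. *)
Definition reflect_cycle (i : nat) : nat := if 0 < i < g then g - i else i.

Lemma reflect_cycle_range i : 1 <= i <= N -> 1 <= reflect_cycle i <= N.
Proof. by rewrite /reflect_cycle; case: ifP; lia. Qed.

Lemma reflect_cycleK : involutive reflect_cycle.
Proof. by move=> i; rewrite /reflect_cycle; do !case: ifP; lia. Qed.

Lemma lollipop_adj_reflect i j : 1 <= i <= N -> 1 <= j <= N ->
  lollipop_adj g (reflect_cycle i) (reflect_cycle j) = lollipop_adj g i j.
Proof.
rewrite /lollipop_adj /reflect_cycle => iP jP.
by do 2!case: ifP => ?; apply/idP/idP; lia.
Qed.

Lemma tight_reflect (u : pred nat) :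
  tight g N u -> tight g N (u \o reflect_cycle).
Proof.
move=> tu X domX.
have -> : count (u \o reflect_cycle) (iota 1 N) = count u (iota 1 N).
  rewrite -count_map; apply/permP/uniq_perm; rewrite ?iota_uniq //.
    by rewrite map_inj_uniq ?iota_uniq //; apply: inv_inj reflect_cycleK.
  move=> i; apply/mapP/idP => [[j]|].
    by rewrite !mem_iota add1n !ltnS => jP ->; apply: reflect_cycle_range.
  rewrite mem_iota add1n ltnS => iP; exists (reflect_cycle i).
    by rewrite mem_iota add1n ltnS; apply: reflect_cycle_range.
  by rewrite reflect_cycleK.
rewrite -(size_map reflect_cycle X); apply: tu => i iP ui.
have riP := reflect_cycle_range iP.
have [|j jP /andP[adj_ij cj]] := domX _ riP; first by rewrite /= reflect_cycleK.
exists (reflect_cycle j); first exact: reflect_cycle_range.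
apply/andP; split.
  rewrite -(inj_eq (inv_inj reflect_cycleK)) reflect_cycleK.
  by rewrite -lollipop_adj_reflect ?reflect_cycleK //; apply: reflect_cycle_range.
by case/orP: cj => [->//|jX]; rewrite map_f ?orbT.
Qed.

(** The cases are v_g in S, then v_{g-1} in S, then v_1 in S by reflection; if all three are in U,
    [tight_ends_covered] applies. The list in the conclusion reads v_0 as v_g. *)
Lemma tight_classification (u : pred nat) p : tight g N u -> u N = false ->
  1 <= p <= g -> u p = false ->
  count u (iota 1 g) <= 1 \/
  exists2 i, 1 <= i < g & forall j, 1 <= j <= N ->
    u j = (j \in [:: if i == 1 then g else i.-1; i; i.+1]).
Proof.
move=> tu uN pP up; case ug: (u g); last first.
  have NE : 1 + N.-1 = N by lia.
  have /defect_Covered_le1 := tight_Covered tu uN ug.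
  rewrite NE => -[none|[q qP [uq none /defect_Free_eq0]]].
    left; rewrite (@leq_trans 0) //; apply: (@count_le_size u 1 g [::]) => i iP.
    by have [->|ig] := eqVneq i g; rewrite ?ug // none //; lia.
  rewrite (_ : q.+1 + (N - q.+1) = N); last by lia.
  case=> [none'|[qN uq1 uq2 none']].
    left; apply: (@count_le_size u 1 g [:: q]) => i iP ui.
    rewrite inE; apply/contraT => iq; move: ui.
    have [->|ig] := eqVneq i g; rewrite ?ug //.
    by have [ltiq|gtiq] := ltnP i q; [rewrite none|rewrite none']; lia.
  (* The run of three avoids g, so it lies entirely past the cycle or entirely before v_g. *)
  have [gq|] := ltnP g q.
    left; rewrite (@leq_trans 0) //; apply: (@count_le_size u 1 g [::]) => i iP.
    by rewrite none //; lia.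
  have : g != q by apply/eqP => gq; rewrite gq uq in ug.
  have : g != q.+1 by apply/eqP => gq; rewrite gq uq1 in ug.
  have : g != q.+2 by apply/eqP => gq; rewrite gq uq2 in ug.
  move=> gq2 gq1 gq0 leqg; right; exists q.+1; first by lia.
  move=> j jP; rewrite (_ : (q.+1 == 1) = false) /=; last by lia.
  have [->|jN] := eqVneq j N; first by rewrite uN !inE; lia.
  have [->|j0] := eqVneq j q; first by rewrite uq inE eqxx.
  have [->|j1] := eqVneq j q.+1; first by rewrite uq1 !inE eqxx orbT.
  have [->|j2] := eqVneq j q.+2; first by rewrite uq2 !inE eqxx !orbT.
  rewrite !inE (negbTE j0) (negbTE j1) (negbTE j2) /=.
  by have [ltjq|gtjq] := ltnP j q; [rewrite none|rewrite none']; lia.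
have ltgN: g < N by apply: lt_last ug => //; lia.
case ug1: (u g.-1); last first.
  have [L + uL] := tight_end_covered tu uN ug ug1.
  rewrite !inE => /or3P[] /eqP LE.
  - left; apply: (@count_le_size u 1 g [:: g]) => i iP.
    by rewrite uL ?LE //; lia.
  - by right; exists 1; rewrite -?LE //; lia.
  (* The triple running into the tail meets the cycle in v_g only. *)
  left; apply: (@count_le_size u 1 g [:: g]) => i iP.
  by rewrite uL ?LE // ?inE; lia.
case u1: (u 1); first by case: (tight_ends_covered tu uN ug pP up).
have rhi i : g <= i -> reflect_cycle i = i.
  by rewrite /reflect_cycle => ig; case: ifP => //; lia.
have [|||L + uL] := tight_end_covered (tight_reflect tu).
- by rewrite /= rhi.
- by rewrite /= rhi.
- by rewrite /= /reflect_cycle; case: ifP; [rewrite (_ : g - g.-1 = 1)|]; lia.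
have {}uL i : 1 <= i <= N -> u i = (reflect_cycle i \in L).
  by move=> iP; rewrite -uL /= ?reflect_cycleK //; apply: reflect_cycle_range.
rewrite !inE => /or3P[] /eqP LE.
- left; apply: (@count_le_size u 1 g [:: g]) => i iP.
  by rewrite uL ?LE /reflect_cycle ?inE; try case: ifP; lia.
(* Reflecting g, 1, 2 gives g, g - 1, g - 2, centred at g - 1. *)
- right; exists g.-1; first by lia.
  move=> j jP; rewrite uL // LE (_ : (g.-1 == 1) = false); last by lia.
  by rewrite /reflect_cycle !inE; case: ifP => ?; apply/idP/idP; lia.
left; apply: (@count_le_size u 1 g [:: g]) => i iP.
by rewrite uL ?LE /reflect_cycle ?inE; try case: ifP; lia.
Qed.

End Tight.

(** * Graphs *)

Section FGraph.

Variables (g l : nat) (T : finType) (e : rel T) (v : nat -> T).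
Hypotheses (simple_e : simple_graph e) (F_e : F_graph g l e v) (g_ge5 : 5 <= g).

Let N := g + l - 1.
Let u i := ~~ p_dominator e (v i).

Lemma F_graph_pendant_last : pendant e (v (g + l)).
Proof.
case: simple_e => sym_e _; case: F_e => g3 l1 inj_v adj_v pend.
apply/cards1P; exists (v N); apply/setP => y; rewrite !inE; apply/idP/eqP.
  case: (pickP [pred i : 'I_(g + l).+1 | (0 < i) && (y == v i)]) => [i|noi].
    move=> /andP[i0 /eqP ->]; rewrite adj_v ?inE; [|lia|have := ltn_ord i; lia].
    rewrite /lollipop_adj => adj; congr v; rewrite /N.
    have := ltn_ord i; lia.
  move=> eyx; have [|i iP nbrs_y] := pend y.
    move=> i iP yE; have iord : i < (g + l).+1 by lia.
    by have := noi (Ordinal iord); rewrite /= yE eqxx; lia.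
  have : v (g + l) \in nbrs e y by rewrite inE sym_e.
  rewrite nbrs_y inE => /eqP/inj_v; rewrite !inE; lia.
move=> ->; rewrite adj_v ?inE /lollipop_adj /N; lia.
Qed.

Lemma F_graph_last_p_dominator : p_dominator e (v N).
Proof.
case: F_e => g3 l1 inj_v adj_v pend.
apply/existsP; exists (v (g + l)); rewrite F_graph_pendant_last andbT.
by rewrite adj_v ?inE /lollipop_adj /N; lia.
Qed.

Lemma F_graph_not_pendant i : 1 <= i <= N -> ~~ pendant e (v i).
Proof.
case: F_e => g3 l1 inj_v adj_v pend; rewrite /N => iP.
(* Besides v_{i+1}, a second neighbour of v_i is v_g if i = 1 and v_{i-1} otherwise. *)
have [j [jP ji adj_ij]] : exists j, [/\ 1 <= j <= g + l, j != i.+1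
    & lollipop_adj g i j].
  have [->|i1] := eqVneq i 1; first by exists g; rewrite lollipop_adj1g; split; lia.
  by exists i.-1; rewrite /lollipop_adj; split; lia.
apply/cards1P => -[y nbrs_i].
have : v j \in nbrs e (v i) by rewrite inE adj_v ?inE //; lia.
have : v i.+1 \in nbrs e (v i) by rewrite inE adj_v ?inE ?lollipop_adjS //; lia.
rewrite nbrs_i !inE => /eqP <- /eqP /inj_v; rewrite !inE; lia.
Qed.

Let S := [set v (i : 'I_N).+1 | i in [pred i : 'I_N | ~~ u i.+1]].
Let A := [set v (i : 'I_N).+1 | i : 'I_N].

Lemma F_graph_inj : injective (fun i : 'I_N => v i.+1).
Proof.
case: F_e => g3 l1 inj_v adj_v pend i j /inj_v; rewrite !inE => ij.
by apply/val_inj/eq_add_S/ij; have := ltn_ord i; have := ltn_ord j; rewrite /N; lia.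
Qed.

Lemma F_graph_card_nonpendant : #|A| = N.
Proof. by rewrite card_imset ?card_ord //; apply: F_graph_inj. Qed.

Lemma count_ord_iota (p : pred nat) m :
  #|[pred i : 'I_m | p i.+1]| = count p (iota 1 m).
Proof.
rewrite -sum1_card big_mkcond /= -(big_mkord xpredT (fun i => if p i.+1 then 1 else 0)).
by rewrite -big_mkcond /= -sum1_count (iotaDl 1 0) big_map /index_iota subn0.
Qed.

Lemma F_graph_card_p_dominators : #|S| + count u (iota 1 N) = N.
Proof.
rewrite card_imset; last exact: F_graph_inj.
rewrite (count_ord_iota (fun i => ~~ u i)) -[in RHS](size_iota 1 N) addnC.
exact: count_predC.
Qed.

(** A pendant vertex has one neighbour, so picking pendant neighbours is injective on S, and no
    picked vertex is among v_1, ..., v_N. As N = |S| + |U|, this is n >= 2|S| + |U|. *)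
Lemma F_graph_order_ge : N + #|S| <= #|T|.
Proof.
case: simple_e => sym_e _.
(* The default [x] is never returned for [x] in S. *)
pose q x := odflt x [pick y | e x y && pendant e y].
have qP x : x \in S -> e x (q x) && pendant e (q x).
  case/imsetP => i; rewrite inE negbK => /existsP[y exy] ->.
  by rewrite /q; case: pickP => [z //|/(_ y)]; rewrite exy.
have injq : {in S &, injective q}.
  move=> x y /qP/andP[ex /cards1P[z zE]] /qP/andP[ey _] qxy.
  have : x \in nbrs e (q x) by rewrite inE sym_e.
  have : y \in nbrs e (q x) by rewrite inE sym_e qxy.
  by rewrite zE !inE => /eqP-> /eqP->.
rewrite -F_graph_card_nonpendant -(card_in_imset injq) -cardsUI.
rewrite [A :&: _](_ : _ = set0) ?cards0 ?addn0 ?max_card //.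
apply/setP => y; rewrite !inE; apply/negP => /andP[/imsetP[i _ ->]].
case/imsetP => x /qP /andP[_ +] qE; rewrite -qE; apply/negP.
by apply: F_graph_not_pendant; have := ltn_ord i; lia.
Qed.

Lemma domination_number_le D : dominating e D -> domination_number e <= #|D|.
Proof.
move=> domD; rewrite /domination_number; case: arg_minnP => [|E _]; last exact.
by apply/forallP => x; rewrite inE.
Qed.

(** S together with X dominates: v_{g+l} through v_N, and an attached vertex through its neighbour,
    which it makes a p-dominator. The bound on |U| then follows from [F_graph_order_ge]. *)
Lemma F_graph_tight : 2 * domination_number e = #|T| - 1 -> tight g N u.
Proof.
case: simple_e => sym_e _; case: F_e => g3 l1 inj_v adj_v pend gammaE X domX.
have inS i : 1 <= i <= N -> ~~ u i -> v i \in S.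
  case: i => // i iP ui; have iN : i < N by lia.
  by apply/imsetP; exists (Ordinal iN).
pose D := S :|: [set x in [seq v i | i <- X]].
suff domD : dominating e D.
  have := domination_number_le domD; have := F_graph_order_ge; have := F_graph_card_p_dominators.
  have : #|D| <= #|S| + size X.
    rewrite (leq_trans (leq_card_setU _ _)) // leq_add2l cardsE.
    by rewrite (leq_trans (card_size _)) ?size_map.
  by move: gammaE; rewrite /N; lia.
apply/forallP => x; apply/orP.
case: (pickP [pred i : 'I_(g + l).+1 | (0 < i) && (x == v i)]) => [i|noi].
  move=> /andP[i0 /eqP ->]; have [iN|Ni] := leqP i N.
    case ui: (u i); last by left; rewrite inE inS ?ui ?i0.
    have [|j jP /andP[adj_ij cj]] := domX i _ ui; first by rewrite i0.
    have vj : v j \in D.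
      rewrite !inE; case/orP: cj => [uj|jX]; first by rewrite inS.
      by rewrite map_f ?orbT.
    case/orP: adj_ij => [/eqP <-|adj_ij]; first by left.
    right; apply/existsP; exists (v j); rewrite vj adj_v // inE; rewrite /N in jP iN *; lia.
  right; apply/existsP; exists (v N); rewrite inE inS /=; last first.
  - by rewrite /u negbK F_graph_last_p_dominator.
  - by rewrite /N; lia.
  have -> : nat_of_ord i = g + l.
    by have := ltn_ord i; move: Ni; rewrite /N; lia.
  by rewrite adj_v ?inE /lollipop_adj /N; lia.
have [|i iP nbrs_x] := pend x.
  move=> i iP xE; have iord : i < (g + l).+1 by lia.
  by have := noi (Ordinal iord); rewrite /= xE eqxx; lia.
have exi : e x (v i).
  have : v i \in nbrs e x by rewrite nbrs_x inE.
  by rewrite inE.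
right; apply/existsP; exists (v i); rewrite exi andbT inE inS //.
  by rewrite /N; lia.
rewrite negbK; apply/existsP; exists x; rewrite sym_e exi.
by rewrite /pendant nbrs_x cards1.
Qed.

Lemma card_cycle_non_p_dominators :
  #|cycle_non_p_dominators g e v| = count u (iota 1 g).
Proof.
case: F_e => g3 l1 inj_v adj_v pend.
rewrite -count_ord_iota -(card_in_imset (f := fun i : 'I_g => v i.+1)).
  apply: eq_card => x; rewrite !inE; apply/andP/imsetP.
    by case=> /imsetP[k _ ->] xu; exists k.
  by case=> k ku ->; split => //; apply/imsetP; exists k.
move=> i j _ _ /inj_v; rewrite !inE => ij; apply/val_inj/eq_add_S/ij.
  by have := ltn_ord i; lia.
by have := ltn_ord j; lia.
Qed.

End FGraph.

(** * Counting and locating the cycle vertices outside S *)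

Theorem theorem3p2 (g l n f : nat) (T : finType) (e : rel T) (v : nat -> T)
  (hsimple : simple_graph e)
  (hconn : connected_graph e)
  (hnonbip : ~ bipartite e)
  (hF : calF_graph g l e v)
  (horder : #|T| = n)
  (hn : g + 1 <= n)
  (hg : 5 <= g)
  (hgamma : 2 * domination_number e = n - 1)
  (hf : #|cycle_non_p_dominators g e v| = f) :
  [/\ f = g -> g = 5,
      f <> g -> f <= 3 /\ f <> 2
    & f = 3 ->
      exists i : nat,
        let W := [set cycle_vertex g v (i - 1); cycle_vertex g v i;
                      cycle_vertex g v (i + 1)] in
        [/\ 1 <= i < g,
            cycle_non_p_dominators g e v = W,
            forall x : T, x \in cycle_vertices g v :\: W -> p_dominator e x
          & forall j : nat, g + 1 <= j <= g + l - 1 -> p_dominator e (v j)]].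
Proof.
case: hF => F_e _; have [g3 l1 inj_v adj_v pend] := F_e.
pose u i := ~~ p_dominator e (v i); pose N := g + l - 1.
have gN : g <= N by rewrite /N; lia.
have tu : tight g N u by apply: F_graph_tight; rewrite ?horder.
have uN : u N = false by rewrite /u F_graph_last_p_dominator.
have fE : count u (iota 1 g) = f by rewrite -hf (card_cycle_non_p_dominators F_e).
have class : f <> g -> f <= 1 \/
  exists2 i, 1 <= i < g & forall j, 1 <= j <= N ->
    u j = (j \in [:: if i == 1 then g else i.-1; i; i.+1]).
  (* As f differs from g, some cycle vertex v_p is in S, as the classification requires. *)
  move=> fg; have /allPn[p] : ~~ all u (iota 1 g).
    by rewrite all_count size_iota fE; apply/eqP.
  rewrite mem_iota add1n ltnS => pP /negbTE up.
  by rewrite -fE; apply: tight_classification up.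
split.
- move=> fg; apply: (tight_full_cycle hg gN tu uN) => i iP.
  have /allP -> // : all u (iota 1 g) by rewrite all_count size_iota fE fg.
  by rewrite mem_iota add1n ltnS.
- move=> /class [f1|[i iP uE]]; first by split; lia.
  (* The three listed indices are distinct and all lie on the cycle. *)
  suff -> : f = 3 by [].
  apply/eqP; rewrite -fE eqn_leq; apply/andP; split.
    apply: (@count_le_size u 1 g [:: if i == 1 then g else i.-1; i; i.+1]) => j jP.
    by rewrite uE //; lia.
  apply: (@count_ge_size u 1 g [:: if i == 1 then g else i.-1; i; i.+1]).
    by rewrite /= !inE; case: ifP; lia.
  move=> j jL; have jP : 1 <= j <= g.
    by move: jL; rewrite !inE; case: ifP; lia.
  by rewrite uE ?jL; lia.
move=> f3; have [|f1|[i iP uE]] := class; [lia|lia|].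
have WE : cycle_non_p_dominators g e v = [set cycle_vertex g v (i - 1);
    cycle_vertex g v i; cycle_vertex g v (i + 1)].
  have -> : cycle_vertex g v (i - 1) = v (if i == 1 then g else i.-1).
    by rewrite /cycle_vertex; case: eqVneq => i1; case: eqVneq => i1'; congr v; lia.
  have -> : cycle_vertex g v i = v i by rewrite /cycle_vertex; case: eqP => //; lia.
  have -> : cycle_vertex g v (i + 1) = v i.+1.
    by rewrite /cycle_vertex addn1.
  set a := if _ then _ else _.
  have aP : 1 <= a <= g by rewrite /a; case: ifP; lia.
  have in_cycle j : 1 <= j <= g -> v j \in cycle_vertices g v.
    case: j => // j jg; apply/imsetP; have jg' : j < g by lia.
    by exists (Ordinal jg').
  apply/setP => x; rewrite [LHS]inE; apply/andP/idP.
    case=> /imsetP[k _ ->]; have := ltn_ord k => kg.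
    rewrite -/(u k.+1) uE; last by lia.
    by rewrite !inE -orbA => /or3P[] /eqP->; rewrite eqxx ?orbT.
  have nonp j : j \in [:: a; i; i.+1] -> 1 <= j <= g ->
      v j \in cycle_vertices g v /\ ~~ p_dominator e (v j).
    by move=> jL jP; split; [exact: in_cycle|rewrite -/(u j) uE //; lia].
  rewrite !inE -orbA => /or3P[] /eqP->; apply: nonp; rewrite ?inE ?eqxx ?orbT //; lia.
exists i; split=> // [x|j jP].
  by rewrite -WE => /setDP[xC]; rewrite inE xC /= negbK.
(* An index beyond g is not among the three, since i + 1 <= g. *)
apply: negbNE; rewrite -/(u j) uE; last by rewrite /N; lia.
by rewrite !inE; case: ifP; lia.
Qed.
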